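(* Let $D$ be a distribution on $X\times Y$, let $S\sim D^n$, let $\mathcal H=\{h_w:w\in\mathbb R^m\}$ be a hypothesis class and let $L$ be a real-valued loss function. Let $\Theta$ be a nonempty set of probability distributions on $\mathbb R^m$ (for which the expectations below are defined). For $Q\in\Theta$ put $\overline w:=\mathbb E_{w\sim Q}[w]$ and $$\Omega_{L,Q,D,S}(n):=\Big(L_D(h_{\overline w})-\mathbb E_{w\sim Q}L_D(h_w)\Big)-\Big(L_S(h_{\overline w})-\mathbb E_{w\sim Q}L_S(h_w)\Big).$$ Assume that there exists a function $g(\Theta,L,S,\delta,n)$ such that, for any $\delta\in(0,1]$, with probability at least $1-\delta$ over $S\sim D^n$, $$\sup_{Q\in\Theta}\Omega_{L,Q,D,S}(n)\le g(\Theta,L,S,\delta,n).$$ Fix $\delta\in(0,1]$, $\lambda>0$, and a prior distribution $P$ on $\mathbb R^m$. Then, with probability at least $1-\delta$ over $S\sim D^n$, we have simultaneously for all $Q\in\Theta$, $$L_D(h_{\overline w})\le L_S(h_{\overline w})+g(\Theta,L,S,\delta/2,n)+\frac1\lambda\Big[D_{\mathrm{KL}}(Q\|P)+\ln\tfrac2\delta+\Psi_{L,P,D}(\lambda,n)\Big],$$ where $$\Psi_{L,P,D}(\lambda,n):=\ln\mathbb E_{w\sim P}\,\mathbb E_{S\sim D^n}\exp\big[\lambda\,(L_D(h_w)-L_S(h_w))\big].$$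
   Context: For a hypothesis $h$ and a sample $S=\{(x_i,y_i)\}_{i=1}^n$, $L_D(h):=\mathbb E_{(x,y)\sim D}[L(h(x),y)]$ and $L_S(h):=\frac1n\sum_{i=1}^n L(h(x_i),y_i)$. $D_{\mathrm{KL}}(Q\|P)$ is the Kullback–Leibler divergence. *)

(* Defs.v *)
From HB Require Import structures.
From mathcomp Require Import all_boot all_order all_algebra.
From mathcomp Require Import all_classical all_reals all_analysis.

Set Implicit Arguments.
Unset Strict Implicit.
Unset Printing Implicit Defensive.

Import Order.TTheory GRing.Theory Num.Theory.
Import numFieldNormedType.Exports.

Local Open Scope classical_set_scope.
Local Open Scope ring_scope.

Section iid.
Context d (T : measurableType d) (R : realType).

Definition tuple_cons n (z : T * n.-tuple T) : n.+1.-tuple T :=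
  [the n.+1.-tuple T of z.1 :: z.2].

Lemma measurable_tuple_cons n : measurable_fun setT (@tuple_cons n).
Proof. exact: measurable_cons. Qed.

HB.instance Definition _ n :=
  isMeasurableFun.Build _ _ _ _ (@tuple_cons n) (@measurable_tuple_cons n).

(* The n-fold product measure P^n on n.-tuple T; see iid_box. *)
Fixpoint iid (P : probability T R) n : probability (n.-tuple T) R :=
  match n return probability (n.-tuple T) R with
  | 0 => \d_([tuple] : 0.-tuple T)
  | n'.+1 => distribution (P \x iid P n')%E (@tuple_cons n')
  end.

Lemma iid_box (P : probability T R) n (A : 'I_n -> set T) :
  (forall i, measurable (A i)) ->
  iid P n [set s | forall i, A i (tnth s i)] = (\prod_(i < n) P (A i))%E.
Proof.
elim: n A => [|n IHn] A mA /=.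
  rewrite big_ord0 diracE mem_set//=; by case.
rewrite big_ord_recl -(IHn (fun i => A (lift ord0 i)))//.
rewrite /distribution /pushforward -product_measure1E//; last first.
  rewrite [X in measurable X](_ : _ =
    \bigcap_(i in [set: 'I_n]) ((@tnth _ T)^~ i @^-1` A (lift ord0 i))).
    apply: fin_bigcap_measurable => // i _.
    by rewrite -[X in measurable X]setTI; exact: measurable_tnth.
  by apply/seteqP; split => s /= h i; [move=> _|]; exact: h.
congr product_measure1; apply/seteqP; split => -[x s] /=.
  move=> h; split; first exact: (h ord0).
  by move=> i; have := h (lift ord0 i); rewrite /tuple_cons tnthS.
move=> [h0 hS] i; case: (unliftP ord0 i) => [j ->|->] //.
by rewrite /tuple_cons tnthS.
Qed.

End iid.

(* The events are not assumed measurable: the bound is on inner probability. *)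
Definition with_prob_ge d (T : measurableType d) (R : realType)
    (P : probability T R) (p : R) (A : set T) : Prop :=
  exists E : set T, [/\ measurable E, E `<=` A & (p%:E <= P E)%E].

(* The derivative is finite everywhere when Q `<< P, so fine loses nothing.
   The integral may be +oo. *)
Definition KL d (T : measurableType d) (R : realType) (Q P : probability T R)
    : \bar R :=
  if `[< Q `<< P >]
  then (\int[Q]_w (ln (fine (Radon_Nikodym (charge_of_finite_measure Q) P w)))%:E)%E
  else +oo%E.

Definition mean (R : realType) m (Q : probability (m.-tuple R) R) : m.-tuple R :=
  [tuple \int[Q]_w tnth w i | i < m].

Section risks.
Context d1 d2 (X : measurableType d1) (Y : measurableType d2) (R : realType).
Variables (Z : Type) (L : Z -> Y -> R).

Definition loss (f : X -> Z) (z : X * Y) : R := L (f z.1) z.2.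

Definition risk (D : probability (X * Y)%type R) (f : X -> Z) : R :=
  \int[D]_z loss f z.

Definition emp_risk n (S : n.-tuple (X * Y)) (f : X -> Z) : R :=
  n%:R^-1 * \sum_(i < n) loss f (tnth S i).

Variables (m : nat) (h : m.-tuple R -> X -> Z).

Definition Omega (Q : probability (m.-tuple R) R)
    (D : probability (X * Y)%type R) n (S : n.-tuple (X * Y)) : R :=
  (risk D (h (mean Q)) - \int[Q]_w risk D (h w)) -
  (emp_risk S (h (mean Q)) - \int[Q]_w emp_risk S (h w)).

Definition Psi (P : probability (m.-tuple R) R)
    (D : probability (X * Y)%type R) (lambda : R) n : \bar R :=
  lne (\int[P]_w \int[iid D n]_S
         (expR (lambda * (risk D (h w) - emp_risk S (h w))))%:E)%E.

Definition risk_defined_ae (P : probability (m.-tuple R) R)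
    (D : probability (X * Y)%type R) : Prop :=
  {ae P, forall w, D.-integrable setT (EFin \o loss (h w))}.

(* The expectations in Omega that do not involve the sample exist. Without
   integrability, the real-valued integrals take junk values. *)
Definition expectations_defined (Q : probability (m.-tuple R) R)
    (D : probability (X * Y)%type R) : Prop :=
  [/\ forall i, Q.-integrable setT (fun w => (tnth w i)%:E),
      D.-integrable setT (EFin \o loss (h (mean Q))),
      risk_defined_ae Q D &
      Q.-integrable setT (fun w => (risk D (h w))%:E)].

End risks.

(* Main.v *)
Require Import Defs.
From HB Require Import structures.
From mathcomp Require Import all_boot all_order all_algebra.
From mathcomp Require Import all_classical all_reals all_analysis.
From mathcomp Require Import measurable_realfun lra.

Set Implicit Arguments.
Unset Strict Implicit.
Unset Printing Implicit Defensive.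

Import Order.TTheory GRing.Theory Num.Theory.
Import numFieldNormedType.Exports.

Local Open Scope classical_set_scope.
Local Open Scope ring_scope.

(* The gap [risk (h wbar) - emp_risk (h wbar)] is [Omega] plus the [Q]-average of
   [risk (h w) - emp_risk (h w)].  The first term is bounded by [g] with
   confidence [delta / 2]; the second is bounded with confidence [delta / 2] by
   change of measure from [Q] to [P] (Donsker-Varadhan) and Markov's inequality
   for the [P]-average of [expR (lambda * (risk (h w) - emp_risk (h w)))].  When
   [Psi = +oo] the right-hand side is [+oo] because [KL] is nonnegative. *)

(** Positive and negative parts are compared separately, so infinite integrals are covered. This
    matters for the integral of the log-density, which may be [+oo]. *)
Lemma le_integral_of_measurable d (T : measurableType d) (R : realType)
    (mu : {measure set T -> \bar R}) (A : set T) (f g : T -> \bar R) :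
  measurable A -> measurable_fun A f -> measurable_fun A g ->
  (forall x, A x -> f x <= g x)%E ->
  (\int[mu]_(x in A) f x <= \int[mu]_(x in A) g x)%E.
Proof.
move=> mA mf mg fg; have fg' : {in A, forall x, (f x <= g x)%E}.
  by move=> x /set_mem; exact: fg.
rewrite integralE [leRHS]integralE leeB//; apply: ge0_le_integral => //;
  do ?[exact: measurable_funepos|exact: measurable_funeneg].
- by move=> x Ax; apply: (funepos_le fg'); exact: mem_set.
- by move=> x Ax; apply: (funeneg_le fg'); exact: mem_set.
Qed.

(** * Change of measure and relative entropy *)

Section donsker_varadhan.
Context d (T : measurableType d) (R : realType).
Implicit Types Q P : probability T R.

(** The two versions of the density agree [P]-a.e., hence [Q]-a.e. since [Q] is dominated by [P].
    The version on the right is finite and nonnegative at every point and comes with a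
    change-of-variables formula. *)
Lemma KL_Radon_Nikodym_SigmaFinite Q P : Q `<< P ->
  KL Q P = (\int[Q]_w (ln (fine (Radon_Nikodym_SigmaFinite.f Q P w)))%:E)%E.
Proof.
move=> QP; rewrite /KL asboolT//; apply: ae_eq_integral => //.
- apply/measurable_EFinP; apply: measurableT_comp; first exact: measurable_ln.
  apply: measurableT_comp; first exact: fine_measurable.
  exact: measurable_int (Radon_Nikodym_integrable _).
- apply/measurable_EFinP; apply: measurableT_comp; first exact: measurable_ln.
  apply: measurableT_comp; first exact: fine_measurable.
  exact: measurable_int (Radon_Nikodym_SigmaFinite.f_integrable _).
- have /(null_dominates_ae_eq measurableT QP) :=
    ae_eq_Radon_Nikodym_SigmaFinite QP measurableT.
  by apply: filterS => w + Tw => /(_ Tw) ->.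
Qed.

(* With [rho = dQ/dP], integrate [1 + t <= expR t] against [Q] for
   [t = phi - ln c - ln rho]; after the change of variables
   [\int[Q] expR t <= c^-1 * \int[P] expR phi <= 1]. *)
Lemma donsker_varadhan Q P (phi : T -> R) (c : R) :
  0 < c -> Q.-integrable setT (EFin \o phi) ->
  (\int[P]_w (expR (phi w))%:E <= c%:E)%E ->
  (\int[Q]_w (phi w)%:E <= KL Q P + (ln c)%:E)%E.
Proof.
move=> c0 iphi Pphi; have [QP|nQP] := pselect (Q `<< P); last first.
  by rewrite /KL asboolF// addye// leey.
rewrite KL_Radon_Nikodym_SigmaFinite//.
set r := Radon_Nikodym_SigmaFinite.f Q P.
have mphi : measurable_fun setT phi.
  exact/measurable_EFinP/measurable_int/iphi.
have mr : measurable_fun setT r.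
  exact: measurable_int (Radon_Nikodym_SigmaFinite.f_integrable _).
have mlnr : measurable_fun setT (fun w => ln (fine (r w))).
  apply: measurableT_comp; first exact: measurable_ln.
  by apply: measurableT_comp; first exact: fine_measurable.
pose u w := expR (phi w - ln c - ln (fine (r w))).
have mu : measurable_fun setT u.
  apply: measurableT_comp; first exact: measurable_expR.
  by apply: measurable_funB => //; exact: measurable_funB.
have u1 : (\int[Q]_w (u w)%:E <= 1)%E.
  rewrite -(Radon_Nikodym_SigmaFinite.change_of_variables QP)//; first last.
  - exact/measurable_EFinP.
  - by move=> w; rewrite lee_fin expR_ge0.
  rewrite -/r.
  apply: (@le_trans _ _ (\int[P]_w ((c^-1)%:E * (expR (phi w))%:E))%E).
    apply: ge0_le_integral => //.
    - move=> w _; rewrite mule_ge0// ?lee_fin ?expR_ge0//.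
      exact: Radon_Nikodym_SigmaFinite.f_ge0.
    - by apply: emeasurable_funM => //; exact/measurable_EFinP.
    - apply: emeasurable_funM => //; apply/measurable_EFinP.
      by apply: measurableT_comp => //; exact: measurable_expR.
    - move=> w _.
      have := Radon_Nikodym_SigmaFinite.f_ge0 QP w.
      have := Radon_Nikodym_SigmaFinite.f_fin_num QP w.
      rewrite -/r /u; case: (r w) => //= x _; rewrite lee_fin le_eqVlt.
      (* Where the density vanishes, [ln 0 = 0] makes [u] a meaningless positive value, but the
         factor [r w = 0] removes it. Elsewhere the two sides are equal. *)
      move=> /predU1P[<-|x0].
        by rewrite mule0 lee_fin mulr_ge0 ?expR_ge0 ?invr_ge0 ?ltW.
      rewrite -!EFinM lee_fin !expRB !lnK ?posrE//.
      by rewrite divfK ?gt_eqF// mulrC.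
  rewrite ge0_integralZl_EFin ?invr_ge0 ?(ltW c0)//; last first.
    apply/measurable_EFinP.
    by apply: measurableT_comp => //; exact: measurable_expR.
  by rewrite lee_pdivrMl// mule1.
have iu : Q.-integrable setT (EFin \o u).
  apply/integrableP; split; first exact/measurable_EFinP.
  under eq_integral do rewrite gee0_abs ?lee_fin ?expR_ge0//.
  by apply: le_lt_trans u1 _; rewrite ltry.
have iphi1 : Q.-integrable setT (EFin \o (fun w => phi w + (1 - ln c))).
  rewrite (_ : _ \o _ = (EFin \o phi) \+ cst (1 - ln c)%:E)//.
  by apply: integrableD => //; exact: finite_measure_integrable_cst.
(* This is the inequality [1 + t <= expR t] solved for the log-density, so that everything known to
   be integrable stands on the left. *)
have : (\int[Q]_w ((phi w + (1 - ln c))%:E - (u w)%:E) <=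
        \int[Q]_w (ln (fine (r w)))%:E)%E.
  apply: le_integral_of_measurable => //.
  - by apply: emeasurable_funB; apply/measurable_EFinP => //;
      exact: measurable_funD.
  - exact/measurable_EFinP.
  - move=> w _; rewrite -EFinB lee_fin.
    have := expR_ge1Dx (phi w - ln c - ln (fine (r w))).
    by rewrite -/(u w); lra.
rewrite integralB_EFin// integralD_EFin//; last first.
  exact: finite_measure_integrable_cst.
have -> : (\int[Q]_w ((EFin \o (fun=> 1 - ln c)%R) w) = (1 - ln c)%:E)%E.
  by rewrite integral_cst//= probability_setT mule1.
have fphi := integrable_fin_num measurableT iphi.
have fu := integrable_fin_num measurableT iu.
rewrite -(fineK fphi) -(fineK fu) in u1 *.
move: u1; rewrite lee_fin -EFinD => u1.
(* The finite lower bound just obtained excludes [-oo]. *)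
case: (\int[Q]_w (ln (fine (r w)))%:E)%E => [k| |].
- by rewrite -EFinD !lee_fin; lra.
- by move=> _; rewrite addye// leey.
- by rewrite leeNy_eq.
Qed.

(** Gibbs' inequality, as the case of zero [phi] in the variational bound. *)
Lemma KL_ge0 Q P : (0 <= KL Q P)%E.
Proof.
have := @donsker_varadhan Q P (cst 0) 1 ltr01.
rewrite integral0 ln1 adde0; apply.
- exact: finite_measure_integrable_cst.
- under eq_integral do rewrite /= expR0.
  by rewrite integral_cst//= probability_setT mule1.
Qed.

End donsker_varadhan.

(** * Inner probability bounds: union bound and Markov's inequality *)

Section with_prob_ge.
Context d (T : measurableType d) (R : realType).
Implicit Types (P : probability T R) (A B : set T).

Lemma with_prob_geS P (p : R) A B :
  A `<=` B -> with_prob_ge P p A -> with_prob_ge P p B.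
Proof.
by move=> AB [E [mE EA pE]]; exists E; split => //; exact: subset_trans AB.
Qed.

Lemma with_prob_geI P (a b : R) A B :
  with_prob_ge P (1 - a) A -> with_prob_ge P (1 - b) B ->
  with_prob_ge P (1 - (a + b)) (A `&` B).
Proof.
move=> [E [mE EA aE]] [F [mF FB bF]]; exists (E `&` F); split.
- exact: measurableI.
- by move=> x [/EA ? /FB].
- have [fE fF] : P E \is a fin_num /\ P F \is a fin_num.
    by split; exact: fin_num_measure.
  have fEF : P (E `&` F) \is a fin_num.
    by apply: fin_num_measure; exact: measurableI.
  have : (P (~` E `|` ~` F) <= P (~` E) + P (~` F))%E.
    by apply: measureU2; exact: measurableC.
  rewrite -setCI !probability_setC//; last exact: measurableI.
  move: aE bF; rewrite -(fineK fE) -(fineK fF) -(fineK fEF).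
  by rewrite -!EFinB -EFinD !lee_fin; lra.
Qed.

(** The form [1 - 0] lets an almost sure event enter [with_prob_geI] at no cost. *)
Lemma ae_with_prob_ge P A : {ae P, forall x, A x} -> with_prob_ge P (1 - 0) A.
Proof.
move=> [N [mN PN0 AN]]; exists (~` N); split.
- exact: measurableC.
- by move=> x Nx; apply: contrapT => /AN.
- by rewrite probability_setC// PN0 sube0 subr0.
Qed.

Lemma markov_with_prob_ge P (f : T -> \bar R) (delta e : R) :
  0 < delta -> 0 < e -> measurable_fun setT f -> (forall x, 0 <= f x)%E ->
  (\int[P]_x f x <= e%:E)%E ->
  with_prob_ge P (1 - delta) [set x | (f x <= (e / delta)%:E)%E].
Proof.
move=> d0 e0 mf f0 fe; have ed0 : 0 < e / delta by rewrite divr_gt0.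
have mA : measurable [set x | ((e / delta)%:E <= f x)%E].
  by rewrite -[X in measurable X]setTI; exact: emeasurable_fun_c_infty.
exists (~` [set x | ((e / delta)%:E <= f x)%E]); split.
- exact: measurableC.
- by move=> x /= /negP; rewrite -ltNge => /ltW.
- have fA : P [set x | ((e / delta)%:E <= f x)%E] \is a fin_num.
    exact: fin_num_measure.
  have : ((e / delta)%:E * P [set x | ((e / delta)%:E <= f x)%E] <= e%:E)%E.
    apply: le_trans fe; have /= := le_integral_abse P measurableT mf ed0.
    have absf x : `|f x|%E = f x by rewrite gee0_abs.
    under eq_integral do rewrite absf.
    by under eq_fun do rewrite absf; rewrite setTI.
  rewrite probability_setC// -(fineK fA) -EFinM -EFinB !lee_fin.
  by rewrite -mulrA ger_pMr// mulrC ler_pdivrMr// mul1r lerD2l lerN2.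
Qed.

(** A zero integral would force [f = 0] a.e., making the whole space null. *)
Lemma integral_gt0 P (f : T -> \bar R) :
  measurable_fun setT f -> (forall x, 0 < f x)%E -> (0 < \int[P]_x f x)%E.
Proof.
move=> mf f0; rewrite lt0e integral_ge0 ?andbT; last by move=> x _; exact/ltW.
apply/eqP => f_eq0; have : ae_eq P setT f (cst 0%E).
  apply/(ae_eq_integral_abs P measurableT mf); rewrite -f_eq0.
  by apply: eq_integral => x _; rewrite gee0_abs// ltW.
move=> [N [mN PN0 fN]]; have NT : N = setT.
  apply/seteqP; split => // x _; apply: fN => /= /(_ I) fx0.
  by have := f0 x; rewrite fx0 ltxx.
move: PN0; rewrite NT => /(etrans (esym (probability_setT P)))/eqP.
by rewrite onee_eq0.
Qed.

End with_prob_ge.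

(* The exponential moment is averaged over [P] before [Q] is chosen, so a
   single application of Markov's inequality serves all [Q]. *)
Lemma pac_bayes d1 d2 (T1 : measurableType d1) (T2 : measurableType d2)
    (R : realType) (P : probability T1 R) (mu : probability T2 R)
    (phi : T1 * T2 -> R) (delta : R) :
  0 < delta -> measurable_fun setT phi ->
  with_prob_ge mu (1 - delta)
    [set s | forall Q : probability T1 R,
       Q.-integrable setT (fun w => (phi (w, s))%:E) ->
       (\int[Q]_w (phi (w, s))%:E <= KL Q P + (ln delta^-1)%:E +
          lne (\int[P]_w \int[mu]_s (expR (phi (w, s)))%:E))%E].
Proof.
move=> d0 mphi.
pose F z := (expR (phi z))%:E.
have F0 z : (0 < F z)%E by rewrite lte_fin expR_gt0.
have mF : measurable_fun setT F.
  apply/measurable_EFinP.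
  by apply: measurableT_comp => //; exact: measurable_expR.
have mF1 := measurable_fun_fubini_tonelli_F (m2 := mu) F mF (fun z => ltW (F0 z)).
have mF2 := measurable_fun_fubini_tonelli_G (m1 := P) F mF (fun z => ltW (F0 z)).
(* Positivity makes [lne] of the moment a genuine logarithm and [e / delta] an admissible constant
   for [donsker_varadhan]. *)
have e0 : (0 < \int[P]_w \int[mu]_s F (w, s))%E.
  apply: integral_gt0 => // w; apply: integral_gt0 => //.
  exact: measurable_fun_pair2.
(* Tonelli identifies the moment with the [mu]-expectation of the [P]-average, to which Markov's
   inequality applies. *)
have eE := @fubini_tonelli _ _ _ _ R P mu F mF (fun z => ltW (F0 z)).
rewrite -/F; case eq_e : (\int[P]_w \int[mu]_s F (w, s))%E e0 => [e| |]// e0.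
- have {}e0 : 0 < e by rewrite -lte_fin.
  rewrite lne_EFin//.
  have := @markov_with_prob_ge _ _ _ mu (fubini_G P F) _ e d0 e0 mF2.
  move=> /(_ (fun s => integral_ge0 _ (fun w _ => ltW (F0 (w, s))))).
  rewrite -eE eq_e lexx => /(_ isT); apply: with_prob_geS => s Fs Q iQ.
  have := donsker_varadhan (divr_gt0 e0 d0) iQ Fs.
  by rewrite lnM ?posrE ?invr_gt0// EFinD [((ln e)%:E + _)%E]addeC addeA.
- exists setT; split => //; last first.
    by rewrite probability_setT lee_fin gerDl oppr_le0 ltW.
  (* Since [-oo + +oo = -oo] in [\bar R], the sum is [+oo] only once the other terms are known to
     exceed [-oo]. *)
  move=> s _ Q _ /=; rewrite addey ?leey//.
  by rewrite -ltNye (lt_le_trans (ltNyr (ln delta^-1)))// leeDr// KL_ge0.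
Qed.

(** Tonelli gives measurability for the positive and negative parts; their difference, and its image
    under [fine], stay measurable even where infinite. *)
Lemma measurable_fun_Rintegral d1 d2 (T1 : measurableType d1)
    (T2 : measurableType d2) (R : realType)
    (mu : {sigma_finite_measure set T2 -> \bar R}) (f : T1 * T2 -> R) :
  measurable_fun setT f ->
  measurable_fun setT (fun x => \int[mu]_y f (x, y)).
Proof.
move=> /measurable_EFinP mf.
apply: measurableT_comp; first exact: fine_measurable.
rewrite (_ : (fun x => _) =
    fubini_F mu (EFin \o f)^\+ \- fubini_F mu (EFin \o f)^\-)%E.
  apply: emeasurable_funB; apply: measurable_fun_fubini_tonelli_F => //.
  - exact: measurable_funepos.
  - exact: measurable_funeneg.
apply/funext => x; rewrite integralE /fubini_F; congr (_ - _)%E;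
  by apply: eq_integral => y _; rewrite ?funeposE ?funenegE.
Qed.

(** * Measurability of the true and empirical risks *)

Section generalization_gap.
Context d1 d2 (X : measurableType d1) (Y : measurableType d2) (R : realType).
Variables (Z : Type) (L : Z -> Y -> R) (m n : nat) (h : m.-tuple R -> X -> Z).
Variable D : probability (X * Y)%type R.
Hypothesis mL : measurable_fun setT
  (fun wz : (m.-tuple R * (X * Y))%type => loss L (h wz.1) wz.2).

Lemma measurable_risk : measurable_fun setT (fun w => risk L D (h w)).
Proof. exact: (measurable_fun_Rintegral D mL). Qed.

Lemma measurable_emp_risk : measurable_fun setT
  (fun wS : (m.-tuple R * n.-tuple (X * Y))%type => emp_risk L wS.2 (h wS.1)).
Proof.
apply: measurable_funM; first exact: measurable_cst.
apply: measurable_sum => i.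
have mtnth : measurable_fun setT
    (fun wS : (m.-tuple R * n.-tuple (X * Y))%type => (wS.1, tnth wS.2 i)).
  apply: measurable_fun_pair; first exact: measurable_fst.
  exact: (measurableT_comp (measurable_tnth i) measurable_snd).
exact: (measurableT_comp mL mtnth).
Qed.

End generalization_gap.

Theorem corollary3p5 (R : realType)
  (d1 d2 : measure_display) (X : measurableType d1) (Y : measurableType d2)
  (D : probability (X * Y)%type R) (n : nat) (n_gt0 : (0 < n)%N)
  (m : nat) (Z : Type) (h : m.-tuple R -> X -> Z) (L : Z -> Y -> R)
  (mL : measurable_fun setT
          (fun wz : (m.-tuple R * (X * Y))%type => loss L (h wz.1) wz.2))
  (Theta : set (probability (m.-tuple R) R)) (Theta0 : Theta !=set0)
  (Theta_def : forall Q, Theta Q -> expectations_defined L h Q D)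
  (Theta_emp : {ae iid D n, forall S, forall Q, Theta Q ->
     Q.-integrable setT (fun w => (emp_risk L S (h w))%:E)})
  (g : set (probability (m.-tuple R) R) -> (Z -> Y -> R) ->
       forall k : nat, k.-tuple (X * Y)%type -> R -> R)
  (g_bound : forall delta : R, 0 < delta <= 1 ->
     with_prob_ge (iid D n) (1 - delta)
       [set S | (ereal_sup [set (Omega L h Q D S)%:E | Q in Theta]
                 <= (g Theta L n S delta)%:E)%E])
  (delta : R) (delta_01 : 0 < delta <= 1) (lambda : R) (lambda_gt0 : 0 < lambda)
  (P : probability (m.-tuple R) R) (P_def : risk_defined_ae L h P D) :
  with_prob_ge (iid D n) (1 - delta)
    [set S | forall Q, Theta Q ->
       ((risk L D (h (mean Q)))%:E <=
        (emp_risk L S (h (mean Q)) + g Theta L n S (delta / 2))%:E +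
        (lambda^-1)%:E *
          (KL Q P + (ln (2 / delta))%:E + Psi L h P D lambda n))%E].
Proof.
pose phi (wS : m.-tuple R * n.-tuple (X * Y)) :=
  lambda * (risk L D (h wS.1) - emp_risk L wS.2 (h wS.1)).
have mphi : measurable_fun setT phi.
  apply: measurable_funM; first exact: measurable_cst.
  apply: measurable_funB; last exact: measurable_emp_risk.
  exact: (measurableT_comp (measurable_risk D mL) measurable_fst).
have d2_01 : 0 < delta / 2 <= 1 by move: delta_01; lra.
have [d2_gt0 _] := andP d2_01.
(* The failure probabilities add up to [delta / 2 + delta / 2 + 0]; the null event is where some
   empirical risk fails to be [Q]-integrable. *)
have := with_prob_geI (with_prob_geI (g_bound _ d2_01)
  (pac_bayes P (iid D n) d2_gt0 mphi)) (ae_with_prob_ge Theta_emp).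
rewrite addr0 -splitr; apply: with_prob_geS => S [[gS pacS] empS] Q ThQ.
have [_ _ _ irisk] := Theta_def Q ThQ.
have iemp := empS Q ThQ.
have omegaS : Omega L h Q D S <= g Theta L n S (delta / 2).
  by rewrite -lee_fin; apply: le_trans gS; apply: ereal_sup_ubound; exists Q.
have igap : Q.-integrable setT
    (EFin \o (fun w => risk L D (h w) - emp_risk L S (h w))).
  rewrite (_ : _ \o _ = (fun w => (risk L D (h w))%:E) \-
                        (fun w => (emp_risk L S (h w))%:E))%E//.
  exact: integrableB.
have iphi : Q.-integrable setT (fun w => (phi (w, S))%:E).
  under eq_fun do rewrite /phi EFinM.
  exact: integrableZl.
(* Integrability ensures that the real-valued integrals in [Omega] are true expectations, so
   linearity applies. *)
have phiE : (\int[Q]_w (phi (w, S))%:E = (lambda *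
    (\int[Q]_w risk L D (h w) - \int[Q]_w emp_risk L S (h w))%R)%:E)%E.
  rewrite -(RintegralB _ irisk iemp)// -(RintegralZl _ _ igap)//.
  by rewrite /Rintegral fineK//; exact: integrable_fin_num.
have := pacS Q iphi; rewrite phiE invf_div -/(Psi L h P D lambda n).
(* If the bracket is finite, divide by [lambda] and add the bound on [Omega]; if it is [+oo], so is
   the right-hand side; [-oo] cannot bound a finite integral. *)
case: (_ + Psi L h P D lambda n)%E => [k| |].
- rewrite lee_fin mulrC -ler_pdivlMr// => gapk.
  rewrite -EFinM -EFinD lee_fin.
  by move: omegaS; rewrite /Omega; lra.
- by move=> _; rewrite gt0_muley ?lte_fin ?invr_gt0// addey// leey.
- by rewrite leeNy_eq.
Qed.
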